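(* Let $\boldsymbol V_h\times Q_h$ be a mixed aggregated finite element space as described in the context. Assume: (1) (weak inf-sup condition) there is a positive constant $\beta_q$ such that for every $p_h\in Q_h$ there exists $\boldsymbol v_h\in\boldsymbol V_h$ with $$\frac1{\beta_q}\|p_h\|_\Omega^2\le b_h(\boldsymbol v_h,p_h)+\sum_{F\in\mathcal F_h^-}h\,\|[\![p_h]\!]\|_F^2+\sum_{A\in\mathcal T_h^-}\|p_h-\pi_h^{-,0}(p_h)\|_A^2,\qquad |||\boldsymbol v_h|||_h\le\|p_h\|_\Omega ;$$ (2) (pressure stabilization) the stabilization form $j_h$ is positive semidefinite on $\boldsymbol V_h\times Q_h$ and there are positive constants $\gamma_j,\xi_j$ such that for all $(\boldsymbol u_h,p_h),(\boldsymbol v_h,q_h)\in\boldsymbol V_h\times Q_h$ $$\frac1{\gamma_j}j_h(\boldsymbol u_h,p_h,\boldsymbol u_h,p_h)\ge\sum_{A\in\mathcal T_h^-}\|p_h-\pi_h^{-,0}(p_h)\|_A^2+\sum_{F\in\mathcal F_h^-}h\|[\![p_h]\!]\|_F^2-\frac{\gamma_a}{2\gamma_j}|||\boldsymbol u_h|||_h^2,$$ $$j_h(\boldsymbol u_h,p_h,\boldsymbol v_h,q_h)\le\xi_j\,|||\boldsymbol u_h,p_h|||_h\,|||\boldsymbol v_h,q_h|||_h .$$ Then there is a positive constant $\beta_d$ such that for every $(\boldsymbol u_h,p_h)\in\boldsymbol V_h\times Q_h$ $$\frac1{\beta_d}|||\boldsymbol u_h,p_h|||_h\le\sup_{(\boldsymbol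 v_h,q_h)\in\boldsymbol V_h\times Q_h}\frac{A_h(\boldsymbol u_h,p_h,\boldsymbol v_h,q_h)}{|||\boldsymbol v_h,q_h|||_h},$$ where $A_h(\boldsymbol u,p,\boldsymbol v,q)=a_h(\boldsymbol u,\boldsymbol v)+b_h(\boldsymbol v,p)+b_h(\boldsymbol u,q)-j_h(\boldsymbol u,p,\boldsymbol v,q)$. All constants are independent of $h$ and of how the boundary cuts the mesh cells.
   Context: **Geometry.** $\Omega\subset\mathbb R^d$, $d\in\{2,3\}$, is a bounded open Lipschitz domain with boundary $\Gamma$ and outward normal $\boldsymbol n$ (no distinction is made between $\Omega$ and its computational approximation). $\Omega_{\rm art}\supset\Omega$ is a simple domain meshed by quasi-uniform conforming Cartesian meshes of quadrilaterals/hexahedra of characteristic size $h$. A cell $K$ is internal if $K\subset\Omega$, external if $K\cap\Omega=\emptyset$, cut otherwise. $\mathcal K_h$ is the set of internal and cut cells; $\Omega_{\rm in}$, $\Omega_{\rm act}$ are the unions of the internal, resp. internal and cut, cells. $\mathcal T_h$ is a partition of $\Omega$ into connected aggregates $A=\bigcup_{i=0}^{n_A}K_i\cap\Omega$ with $K_i\in\mathcal K_h$, where $K_0=\mathcal O(A)$ is the only internal cell (the owner) and every cut cell belongs to exactly one aggregate; aggregates have characteristic size at most $\gamma h$ with $\gamma$ constant. ''Constant'' always means independent of $h$ and of how $\Gamma$ cuts the cells. **Spaces.** $\mathcal Q_q(K)$: polynomials of degree at most $q$ in each coordinate. A vertex/edge/face (VEF) is outer if it belongs to a cut cell but to no internal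 cell; each outer VEF is assigned to one aggregate containing it. An outer node $a$ (Lagrangian node of $\Omega_{\rm act}$ not in $\Omega_{\rm in}$) has an owner internal cell $\mathcal O(a)$: the owner of the aggregate assigned to the lowest-dimensional VEF containing $a$, or of the aggregate containing the cell if $a$ is interior to a cut cell. The aggregated space $\mathcal Q_{q,h}$ consists of the continuous functions $v_h$ on $\Omega_{\rm act}$ with $v_h|_K\in\mathcal Q_q(K)$ for $K\in\mathcal K_h$ such that at every outer node $v_h(\boldsymbol x^a)$ equals the value at $\boldsymbol x^a$ of the polynomial $v_h|_{\mathcal O(a)}$ (extended to $\mathbb R^d$). The space $\breve{\mathcal Q}_{q,h}$ is defined the same way but with $v_h|_{\mathcal O(a)}$ replaced by its nodal interpolant in the serendipity space of $\mathcal O(a)$ (polynomials of superlinear degree at most $q$, i.e. total degree not counting variables entering a monomial linearly). $\mathcal P^-_{r,h}$: functions on $\Omega$ whose restriction to each $A\in\mathcal T_h$ is a polynomial of total degree at most $r$. $\boldsymbol V_h$ is a vector-valued aggregated space whose components lie in $\mathcal Q_{q,h}$ or in $\breve{\mathcal Q}_{q,h}$, and $Q_h=\mathcal P^-_{q-1,h}\cap L^2_0(\Omega)$, $q\ge2$, where $L^2_0(\Omega)$ is the space of $L^2$ functions with zero mean. **Forms and norms.** $(\cdot,\cdot)_\omega$, $\|\cdot\|_\omega$: $L^2(\omega)$ product and norm. $\partial_{\boldsymbol n}=\boldsymbol n\cdot\nabla$. $$a_h(\boldsymbol u,\boldsymbol v)=(\nabla\boldsymbol u,\nabla\boldsymbol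 v)_\Omega-(\partial_{\boldsymbol n}\boldsymbol u,\boldsymbol v)_\Gamma-(\partial_{\boldsymbol n}\boldsymbol v,\boldsymbol u)_\Gamma+\tau(h^{-1}\boldsymbol u,\boldsymbol v)_\Gamma,\qquad b_h(\boldsymbol v,p)=-(\nabla\cdot\boldsymbol v,p)_\Omega+(\boldsymbol n\cdot\boldsymbol v,p)_\Gamma,$$ $$A_h(\boldsymbol u,p,\boldsymbol v,q)=a_h(\boldsymbol u,\boldsymbol v)+b_h(\boldsymbol v,p)+b_h(\boldsymbol u,q)-j_h(\boldsymbol u,p,\boldsymbol v,q),$$ where $j_h$ is a bilinear form in the pairs $(\boldsymbol u,p)$ and $(\boldsymbol v,q)$ (the pressure stabilization), and $$|||\boldsymbol u|||_h^2=\|\nabla\boldsymbol u\|_\Omega^2+\|h^{-1/2}\boldsymbol u\|_\Gamma^2,\qquad |||\boldsymbol u,p|||_h^2=|||\boldsymbol u|||_h^2+\|p\|_\Omega^2.$$ $\tau$ is a large enough positive constant so that, for positive constants $\gamma_a,\xi_a$, $a_h(\boldsymbol u_h,\boldsymbol u_h)\ge\gamma_a|||\boldsymbol u_h|||_h^2$ and $a_h(\boldsymbol u_h,\boldsymbol v_h)\le\xi_a|||\boldsymbol u_h|||_h|||\boldsymbol v_h|||_h$ on $\boldsymbol V_h$. $\pi_h^{-,0}$ is the $L^2$ projection onto functions constant on each aggregate. **Improper interfaces and aggregates.** $\mathcal F_h$ is the set of interfaces $F_{AB}=\partial A\cap\partial B$ (of positive $(d-1)$-measure) of distinct aggregates $A,B$;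 $[\![\cdot]\!]$ is the jump across $F$. An interface bubble for $F=F_{AB}$ is $\boldsymbol\phi\in\boldsymbol V_h$ supported in $AB:=A\cup B$ with $\int_F\boldsymbol\phi\cdot\boldsymbol n>C|F|>0$, $\|\boldsymbol\phi\|_\infty\le C$, $\boldsymbol\phi\cdot\boldsymbol n=0$ on $\partial(AB)$. An aggregate bubble for $A$ is a scalar $\phi\in H^1_0(A)$, supported in $A$, with $\phi|_{K\cap A}\in\mathcal Q_2(K)$ for the cells $K$ of $A$, whose zero extension is admissible as a component of a function of $\boldsymbol V_h$, and with $\phi\ge0$, $\int_A\phi>C|A|>0$, $\|\phi\|_\infty\le C$. Here $C$ denotes fixed positive constants (possibly different at each occurrence). $\mathcal F_h^-$ (resp. $\mathcal T_h^-$) is the set of improper interfaces (resp. aggregates), i.e. those admitting no such bubble.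
   Formalization: The lower bound in (2) is also required with -j_h(u,p,u,-p) in place of j_h(u,p,u,p) (automatic if j_h acts on pressures only); without it the claim fails, e.g. for j_h(u,p,v,q)=a_h(u,v) on a mesh without improper interfaces or aggregates. *)

(* Defs.v *)
From HB Require Import structures.
From mathcomp Require Import all_boot all_order all_algebra.
From mathcomp Require Import all_classical all_reals all_analysis.
Set Implicit Arguments.
Unset Strict Implicit.
Unset Printing Implicit Defensive.
Import Order.TTheory GRing.Theory Num.Theory.
Import numFieldNormedType.Exports.
Local Open Scope classical_set_scope.
Local Open Scope ring_scope.

(* Points of R^d are row vectors. The library norm of 'rV[R]_d is the maximum norm; it is used only for its
   topology, all lengths below being Euclidean. *)
Section euclidean.
Context {R : realType} {d : nat}.
Implicit Types x y : 'rV[R]_d.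

Definition dot x y : R := \sum_i x 0 i * y 0 i.
Definition enorm x : R := Num.sqrt (dot x x).
Definition bvec (i : 'I_d) : 'rV[R]_d := delta_mx 0 i.
Definition bdry (A : set 'rV[R]_d) : set 'rV[R]_d := closure A `\` interior A.

Definition diam_le (A : set 'rV[R]_d) (r : R) : Prop :=
  forall x y, A x -> A y -> enorm (x - y) <= r.
Definition diam (A : set 'rV[R]_d) : R :=
  sup [set enorm (xy.1 - xy.2) | xy in A `*` A].

Definition is_outward_normal (A : set 'rV[R]_d) x (n : 'rV[R]_d) : Prop :=
  enorm n = 1 /\
  forall e : R, 0 < e -> exists2 r : R, 0 < r &
    forall y, 0 < enorm (y - x) < r ->
      (e * enorm (y - x) <= dot (y - x) n -> ~ A y) /\
      (dot (y - x) n <= - (e * enorm (y - x)) -> A y).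

Definition outward_normal (A : set 'rV[R]_d) x : 'rV[R]_d :=
  xget 0 [set n | is_outward_normal A x n].

(* Near each boundary point, A is the strict subgraph of a Lipschitz function
   psi in a direction e; psi is only evaluated on the hyperplane orthogonal
   to e. *)
Definition lipschitz_boundary (A : set 'rV[R]_d) : Prop :=
  forall x, bdry A x ->
  exists (e : 'rV[R]_d) (psi : 'rV[R]_d -> R) (r L : R),
    [/\ enorm e = 1, 0 < r,
        forall y z, `|psi y - psi z| <= L * enorm (y - z) &
        forall z, enorm (z - x) < r ->
          (A z <-> dot z e < psi (z - dot z e *: e))].

Definition lipschitz_domain (A : set 'rV[R]_d) : Prop :=
  [/\ A !=set0, open A, connected A, bounded_set A & lipschitz_boundary A].

End euclidean.

(* Outer measures obtained by covering with countable families of sets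
   weighted by a gauge. *)
Section covers.
Context {R : realType} {T : pointedType}.
Local Open Scope ereal_scope.

Definition cover_outer (g : set T -> \bar R) (A : set T) : \bar R :=
  ereal_inf [set \sum_(k <oo) g (F k) | F in
    [set F : (set T)^nat | A `<=` \bigcup_k F k]].

(* Every set is declared measurable, so that mu_ext allows arbitrary covers. *)
Definition all_meas : Type := T.
HB.instance Definition _ := Pointed.on all_meas.
Let all_meas0 : [set: set all_meas] set0. Proof. by []. Qed.
Let all_measC A : [set: set all_meas] A -> [set: set all_meas] (~` A).
Proof. by []. Qed.
Let all_measU (F : (set all_meas)^nat) :
  (forall i, [set: set all_meas] (F i)) -> [set: set all_meas] (\bigcup_i F i).
Proof. by []. Qed.
HB.instance Definition _ := @isMeasurable.Build default_measure_display
  all_meas [set: set all_meas] all_meas0 all_measC all_measU.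

Lemma cover_outerE (g : set T -> \bar R) :
  cover_outer g = mu_ext (g : set all_meas -> \bar R).
Proof.
apply/funext => A; congr ereal_inf; apply/seteqP; split => _ [F FA <-].
  by exists F.
by exists F => //; exact: cover_subset FA.
Qed.

Variable g : set T -> \bar R.
Hypotheses (g0 : g set0 = 0) (g_ge0 : forall A, 0 <= g A).

Lemma cover_outer0 : cover_outer g set0 = 0.
Proof. by rewrite cover_outerE; exact: mu_ext0. Qed.

Lemma cover_outer_ge0 A : 0 <= cover_outer g A.
Proof. by rewrite cover_outerE; exact: mu_ext_ge0. Qed.

Lemma le_cover_outer : {homo cover_outer g : A B / A `<=` B >-> A <= B}.
Proof.
move=> A B AB; rewrite cover_outerE.
exact: (@le_mu_ext _ all_meas _ (g : set all_meas -> \bar R)).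
Qed.

Lemma cover_outer_sigma_subadditive : sigma_subadditive (cover_outer g).
Proof.
rewrite cover_outerE.
exact: (@mu_ext_sigma_subadditive _ all_meas _ (g : set all_meas -> \bar R)).
Qed.


End covers.

Section measures.
Context {R : realType}.
Local Open Scope ereal_scope.

Section lebesgue.
Context {d : nat}.
Implicit Types A : set 'rV[R]_d.

Definition box (a b : 'rV[R]_d) : set 'rV[R]_d :=
  [set x | forall i, (a 0 i <= x 0 i <= b 0 i)%R].

(* Volume of a nonempty box, 0 on the empty set, +oo on any other set. *)
Definition box_gauge A : \bar R :=
  if `[< A = set0 >] then 0 else
  ereal_inf [set (\prod_(i < d) (ab.2 0 i - ab.1 0 i))%:E | ab in
    [set ab : 'rV[R]_d * 'rV[R]_d |
      (forall i, (ab.1 0 i <= ab.2 0 i)%R) /\ A = box ab.1 ab.2]].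

Definition lebesgue_outer : set 'rV[R]_d -> \bar R := cover_outer box_gauge.

Let box_gauge0 : box_gauge set0 = 0.
Proof. by rewrite /box_gauge asboolT. Qed.

Let box_gauge_ge0 A : 0 <= box_gauge A.
Proof.
rewrite /box_gauge; case: asboolP => // _; apply: le_ereal_inf_tmp.
move=> _ [[a b] [/= ab _] <-]; rewrite lee_fin; apply: prodr_ge0 => i _.
by rewrite subr_ge0.
Qed.

HB.instance Definition _ := isOuterMeasure.Build R 'rV[R]_d lebesgue_outer
  (cover_outer0 box_gauge0 box_gauge_ge0) (cover_outer_ge0 box_gauge_ge0)
  (@le_cover_outer _ _ box_gauge)
  (cover_outer_sigma_subadditive box_gauge_ge0).

End lebesgue.

Section hausdorff.
Context {d : nat}.
Variable s : nat.
Implicit Types A : set 'rV[R]_d.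

(* Volume of the unit ball of R^s. *)
Fixpoint ball_volume (k : nat) : R :=
  match k with
  | 0 => 1%R
  | 1 => 2%R
  | k'.+2 => (2 * pi / k'.+2%:R * ball_volume k')%R
  end.

Definition hausdorff_gauge (delta : R) A : \bar R :=
  if `[< A = set0 >] then 0 else
  if `[< diam_le A delta >] then (ball_volume s * (diam A / 2) ^+ s)%:E
  else +oo.

Definition hausdorff_outer A : \bar R :=
  ereal_sup [set cover_outer (hausdorff_gauge delta) A | delta in
    [set delta : R | (0 < delta)%R]].

Let gauge0 delta : hausdorff_gauge delta set0 = 0.
Proof. by rewrite /hausdorff_gauge asboolT. Qed.

Let ball_volume_ge0 k : (0 <= ball_volume k)%R.
Proof.
have [m] := ubnP k; elim: m k => // m IH [|[|k]] // /ltnSE km /=.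
by rewrite mulr_ge0 ?IH//; [rewrite divr_ge0 ?mulr_ge0 ?pi_ge0|exact: ltnW].
Qed.

Let gauge_ge0 delta A : 0 <= hausdorff_gauge delta A.
Proof.
rewrite /hausdorff_gauge; case: asboolP => // _; case: asboolP => // _.
rewrite lee_fin mulr_ge0// exprn_ge0// divr_ge0//.
rewrite /diam; set E := (X in sup X).
have [[[y [xy Exy _]] ubE]|/sup_out ->//] := pselect (has_sup E).
apply: (le_trans (sqrtr_ge0 (dot (xy.1 - xy.2) (xy.1 - xy.2)))).
by apply: ub_le_sup => //; exists xy.
Qed.

Let hausdorff0 : hausdorff_outer set0 = 0.
Proof.
apply/eqP; rewrite eq_le; apply/andP; split.
  apply: ge_ereal_sup => _ [delta _ <-].
  by rewrite (@cover_outer0 _ _ _ (gauge0 delta) (gauge_ge0 delta)).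
apply: ereal_sup_ubound; exists 1%R => //=.
exact: (cover_outer0 (gauge0 1%R) (gauge_ge0 1%R)).
Qed.

Let hausdorff_ge0 A : 0 <= hausdorff_outer A.
Proof.
apply: (le_trans (cover_outer_ge0 (gauge_ge0 1%R) A)).
by apply: ereal_sup_ubound; exists 1%R => /=.
Qed.

Let le_hausdorff : {homo hausdorff_outer : A B / A `<=` B >-> A <= B}.
Proof.
move=> A B AB; apply: ge_ereal_sup => _ [delta delta0 <-].
apply: (le_trans (le_cover_outer _ AB)).
by apply: ereal_sup_ubound; exists delta.
Qed.

Let hausdorff_sigma_subadditive : sigma_subadditive hausdorff_outer.
Proof.
move=> F; apply: ge_ereal_sup => _ [delta delta0 <-].
apply: (le_trans (cover_outer_sigma_subadditive (gauge_ge0 delta) F)).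
apply: lee_nneseries => k *; first exact: (cover_outer_ge0 (gauge_ge0 delta)).
by apply: ereal_sup_ubound; exists delta.
Qed.

HB.instance Definition _ := isOuterMeasure.Build R 'rV[R]_d hausdorff_outer
  hausdorff0 hausdorff_ge0 le_hausdorff hausdorff_sigma_subadditive.

End hausdorff.
End measures.

(* The measures are the restrictions of the outer measures to their
   Caratheodory sigma-algebras. *)
Notation lebT R d :=
  (caratheodory_type (@lebesgue_outer R d : {outer_measure set _ -> \bar _})).
Notation surfT R d :=
  (caratheodory_type (@hausdorff_outer R d d.-1 : {outer_measure set _ -> \bar _})).

Definition leb {R : realType} {d : nat} : set (lebT R d) -> \bar R :=
  @lebesgue_outer R d.
Definition surf {R : realType} {d : nat} : set (surfT R d) -> \bar R :=
  @hausdorff_outer R d d.-1.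

HB.instance Definition _ (R : realType) d := isMeasure.Build _ _ _ (@leb R d)
  (@caratheodory_measure0 R _ (@lebesgue_outer R d))
  (@caratheodory_measure_ge0 R _ (@lebesgue_outer R d))
  (@caratheodory_measure_sigma_additive R _ (@lebesgue_outer R d)).
HB.instance Definition _ (R : realType) d := isMeasure.Build _ _ _ (@surf R d)
  (@caratheodory_measure0 R _ (@hausdorff_outer R d d.-1))
  (@caratheodory_measure_ge0 R _ (@hausdorff_outer R d d.-1))
  (@caratheodory_measure_sigma_additive R _ (@hausdorff_outer R d d.-1)).

(* A normal on the boundary of a Lipschitz domain exists only almost
   everywhere. *)
Definition outward_normal_field {R : realType} {d : nat} (Om : set 'rV[R]_d)
    (nu : 'rV[R]_d -> 'rV[R]_d) : Prop :=
  (forall i, measurable_fun (bdry Om : set (surfT R d))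
               (fun x : surfT R d => (nu x 0 i : R))) /\
  {ae surf, forall x : surfT R d, bdry Om x -> is_outward_normal Om x (nu x)}.

Section polynomials.
Context {R : realType} {d : nat}.
Implicit Types f : 'rV[R]_d -> R.

Definition multiindex (m : nat) := {ffun 'I_d -> 'I_m.+1}.

Definition poly_span m (P : pred (multiindex m)) f : Prop :=
  exists c : multiindex m -> R, forall x,
    f x = \sum_(al | P al) c al * \prod_i x 0 i ^+ al i.

Definition polyQ q f := poly_span (@predT (multiindex q)) f.

Definition polyP r f :=
  poly_span [pred al : multiindex r | (\sum_i al i <= r)%N] f.

(* Superlinear degree at most q: exponents equal to 1 are not counted. *)
Definition serendipity q f :=
  poly_span [pred al : multiindex q | (\sum_(i | (1 < al i)%N) al i <= q)%N] f.

Definition partial (i : 'I_d) f : 'rV[R]_d -> R := 'D_(bvec i) f.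

Definition smooth f : Prop := forall s : seq 'I_d,
  continuous (foldr partial f s) /\
  forall i x, derivable (foldr partial f s) x (bvec i).

(* The polynomial of class P that coincides with f on A, if there is one. *)
Definition restr_poly (P : ('rV[R]_d -> R) -> Prop) f (A : set 'rV[R]_d) :
    'rV[R]_d -> R :=
  xget (fun=> 0) [set g | P g /\ forall x, A x -> f x = g x].

(* Nodes of the unit cube are l / q. A serendipity element is given by a subset
   of its Lagrangian nodes that is unisolvent for the serendipity space. *)
Definition ref_node q (l : multiindex q) : 'rV[R]_d :=
  \row_i ((l i)%:R / q%:R).

Definition serendipity_unisolvent q (N : {set multiindex q}) : Prop :=
  (forall z : multiindex q -> R, exists2 s, serendipity q s &
     forall l, l \in N -> s (ref_node l) = z l) /\
  (forall s, serendipity q s -> (forall l, l \in N -> s (ref_node l) = 0) ->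
     forall x, s x = 0).

End polynomials.

Section meshes.
Context {R : realType} {d : nat}.

Definition cell_of (n : 'I_d -> nat) := {dffun forall i, 'I_(n i)}.

(* Relatively open mesh entities: in each direction an open interval of the
   grid (inl) or a grid point (inr). *)
Definition entity_of (n : 'I_d -> nat) :=
  {dffun forall i, ('I_(n i) + 'I_(n i).+1)%type}.

(* A tensor-product grid of a box, with characteristic size msize, together
   with an aggregation. The aggregate of owner K is the union of the cells
   that owner maps to K; vef_owner gives the owner of the aggregate to which
   an outer VEF is assigned. The values of owner (vef_owner) are meaningful on
   internal and cut cells (outer VEFs) only. *)
Record agg_mesh := AggMesh {
  msize : R;
  nint : 'I_d -> nat;
  gpt : 'I_d -> nat -> R;
  owner : cell_of nint -> cell_of nint;
  vef_owner : entity_of nint -> cell_of nint }.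

Variables (Om : set 'rV[R]_d) (T : agg_mesh).
Notation cell := (cell_of (nint T)).
Notation entity := (entity_of (nint T)).
Implicit Types K A B : cell.

Definition ocell K : set 'rV[R]_d :=
  [set x | forall i, gpt T i (K i) < x 0 i < gpt T i (K i).+1].
Definition ccell K : set 'rV[R]_d :=
  [set x | forall i, gpt T i (K i) <= x 0 i <= gpt T i (K i).+1].

Definition internal K : bool := `[< ocell K `<=` Om >].
Definition external K : bool := `[< ocell K `&` Om = set0 >].
Definition cut K : bool := ~~ internal K && ~~ external K.
Definition active K : bool := internal K || cut K.

Definition Om_in : set 'rV[R]_d := \bigcup_(K in [set K | internal K]) ccell K.
Definition Om_act : set 'rV[R]_d := \bigcup_(K in [set K | active K]) ccell K.

(* Aggregates are indexed by their owner. *)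
Definition agg A : set 'rV[R]_d :=
  Om `&` \bigcup_(K in [set K | active K && (owner K == A)]) ccell K.

Definition in_closed_entity (e : entity) (x : 'rV[R]_d) : Prop :=
  forall i, match e i with
    | inl k => gpt T i k <= x 0 i <= gpt T i k.+1
    | inr k => x 0 i == gpt T i k
    end.
Definition entity_dim (e : entity) : nat :=
  #|[pred i | if e i is inl _ then true else false]|.
Definition is_vef (e : entity) : bool := (entity_dim e < d)%N.
Definition entity_in_cell (e : entity) K : bool :=
  [forall i, match e i with
    | inl k => k == K i :> nat
    | inr k => (k == K i :> nat) || (k == (K i).+1 :> nat)
    end].
Definition outer_vef (e : entity) : bool :=
  [&& is_vef e, [exists K, cut K && entity_in_cell e K] &
      ~~ [exists K, internal K && entity_in_cell e K]].

Definition admissible_mesh (kappa gamma : R) : Prop :=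
  [/\ 0 < msize T,
      forall i k, (k < nint T i)%N ->
        msize T / kappa <= gpt T i k.+1 - gpt T i k <= kappa * msize T &
      forall x, Om x ->
        forall i, gpt T i 0%N <= x 0 i <= gpt T i (nint T i)] /\
  [/\ forall K, internal K -> owner K = K,
      forall K, cut K -> internal (owner K),
      forall A, internal A -> connected (agg A),
      forall A, internal A -> diam_le (agg A) (gamma * msize T) &
      forall e, outer_vef e -> exists K,
        [/\ active K, entity_in_cell e K & owner K = vef_owner e]].

Section fe.
Variable q : nat.

Definition node K (l : multiindex q) : 'rV[R]_d :=
  \row_i (gpt T i (K i) +
          (l i)%:R / q%:R * (gpt T i (K i).+1 - gpt T i (K i))).

Definition outer_node (x : 'rV[R]_d) : Prop :=
  (exists K l, active K /\ x = node K l) /\ ~ Om_in x.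

Definition node_owner (x : 'rV[R]_d) K : Prop :=
  (exists e, [/\ is_vef e, in_closed_entity e x,
      forall e', is_vef e' -> in_closed_entity e' x ->
        (entity_dim e <= entity_dim e')%N &
      K = vef_owner e]) \/
  (exists2 K', cut K' /\ ocell K' x & K = owner K').

(* The polynomial used for extrapolation from the owner cell K: v|_K itself,
   or its nodal serendipity interpolant. *)
Definition owner_poly (b : bool) (N : {set multiindex q})
    (v : 'rV[R]_d -> R) K (g : 'rV[R]_d -> R) : Prop :=
  if b then serendipity q g /\ forall l, l \in N -> v (node K l) = g (node K l)
  else polyQ q g /\ forall x, ccell K x -> v x = g x.

(* The aggregated spaces: Q_{q,h} for b = false, its serendipity variant for
   b = true. Functions are considered on Om_act only. *)
Definition agg_space (b : bool) (N : {set multiindex q})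
    (v : 'rV[R]_d -> R) : Prop :=
  [/\ {within Om_act, continuous v},
      forall K, active K -> exists2 g, polyQ q g &
        forall x, ccell K x -> v x = g x &
      forall x K, outer_node x -> node_owner x K ->
        exists2 g, owner_poly b N v K g & v x = g x].

End fe.

(* Discontinuous piecewise polynomials; the values on the interfaces between
   aggregates are irrelevant, traces being those of the polynomials. *)
Definition Pminus (r : nat) (p : 'rV[R]_d -> R) : Prop :=
  measurable_fun (Om : set (lebT R d)) (p : lebT R d -> R) /\
  forall A, internal A -> exists2 g, polyP r g &
    forall x, (interior (agg A)) x -> p x = g x.

Definition L20 (p : 'rV[R]_d -> R) : Prop :=
  [/\ measurable_fun (Om : set (lebT R d)) (p : lebT R d -> R),
      (\int[leb]_(x in Om) ((p x) ^+ 2)%:E < +oo)%E &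
      \int[leb]_(x in Om) p x = 0].

(* A cell touching x from inside Om; it is unique for almost every x of Om and
   of its boundary. *)
Definition cell_at (x : 'rV[R]_d) : option cell :=
  [pick K | active K && `[< closure (ocell K `&` Om) x >]].

End meshes.

Arguments agg_mesh R d : clear implicits.

(* The velocity element: degree, components that are of serendipity type, and
   the nodes of the serendipity element. *)
Record velocity_fe (d : nat) := VelocityFE {
  deg : nat;
  ser : 'I_d -> bool;
  snodes : {set @multiindex d deg} }.

Section stokes.
Context {R : realType} {d : nat}.
Variables (Om : set 'rV[R]_d) (nu : 'rV[R]_d -> 'rV[R]_d) (V : velocity_fe d).
Variable T : agg_mesh R d.
Notation cell := (cell_of (nint T)).
Notation vfun := ('rV[R]_d -> 'rV[R]_d).
Notation sfun := ('rV[R]_d -> R).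
Implicit Types (u v : vfun) (p : sfun) (w z : vfun * sfun) (A B : cell).

Definition Vh u : Prop :=
  forall i, agg_space Om T (ser V i) (snodes V) (fun x => u x 0 i).
Definition Qh p : Prop := Pminus Om T (deg V).-1 p /\ L20 Om p.
Definition Wh w : Prop := Vh w.1 /\ Qh w.2.

(* Cellwise gradient, [grad u x]_ij = partial_j u_i; on the boundary of Om it
   is the trace taken from inside Om. *)
Definition grad u (x : 'rV[R]_d) : 'M[R]_d :=
  if cell_at Om T x is Some K then
    \matrix_(i, j) partial j
      (restr_poly (polyQ (deg V)) (fun y => u y 0 i) (ccell K)) x
  else 0.
Definition diver u x : R := \tr (grad u x).
Definition dnormal u (x : 'rV[R]_d) : 'rV[R]_d := nu x *m (grad u x)^T.

Definition agg_poly p A : sfun :=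
  restr_poly (polyP (deg V).-1) p (interior (agg Om A)).
Definition trace p (x : 'rV[R]_d) : R :=
  if cell_at Om T x is Some K then agg_poly p (owner K) x else 0.

Local Notation h := (msize T).

Definition a_h (tau : R) u v : R :=
  \int[leb]_(x in Om) \tr (grad u x *m (grad v x)^T)
  - \int[surf]_(x in bdry Om) dot (dnormal u x) (v x)
  - \int[surf]_(x in bdry Om) dot (dnormal v x) (u x)
  + tau * \int[surf]_(x in bdry Om) dot (h^-1 *: u x) (v x).

Definition b_h v p : R :=
  - \int[leb]_(x in Om) (diver v x * p x)
  + \int[surf]_(x in bdry Om) (dot (nu x) (v x) * trace p x).

Definition A_h (tau : R) (j_h : vfun * sfun -> vfun * sfun -> R) w z : R :=
  a_h tau w.1 z.1 + b_h z.1 w.2 + b_h w.1 z.2 - j_h w z.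

Definition L2norm p : R := Num.sqrt (\int[leb]_(x in Om) (p x ^+ 2)).
Definition normV u : R := Num.sqrt
  (\int[leb]_(x in Om) \tr (grad u x *m (grad u x)^T)
   + \int[surf]_(x in bdry Om) (h^-1 * dot (u x) (u x))).
Definition normW w : R := Num.sqrt (normV w.1 ^+ 2 + L2norm w.2 ^+ 2).

Definition pi0 p : sfun := xget (fun=> 0)
  [set g | Pminus Om T 0 g /\ forall k, Pminus Om T 0 k ->
     \int[leb]_(x in Om) ((p x - g x) * k x) = 0].

Definition iface A B : set 'rV[R]_d := bdry (agg Om A) `&` bdry (agg Om B).
Definition is_iface A B : Prop :=
  [/\ internal Om A, internal Om B, A != B & (0 < surf (iface A B))%E].

Definition jump p A B x : R := agg_poly p A x - agg_poly p B x.

Definition iface_bubble (c C : R) A B u : Prop :=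
  let AB := agg Om A `|` agg Om B in
  [/\ Vh u,
      forall x, Om x -> ~ AB x -> u x = 0,
      c * fine (surf (iface A B)) <
        \int[surf]_(x in iface A B) dot (u x) (outward_normal (agg Om A) x),
      forall x, Om x -> enorm (u x) <= C &
      {ae surf, forall x : surfT R d, bdry AB x ->
         dot (u x) (outward_normal AB x) = 0}].

(* Closure of the test functions on the interior of A in the H^1 norm; g is the
   weak gradient of f. *)
Definition H10 (A : set 'rV[R]_d) (f : sfun) : Prop :=
  exists (psi : nat -> sfun) (g : 'I_d -> sfun),
  [/\ forall n, smooth (psi n),
      forall n, exists2 S, compact S /\ S `<=` interior A &
        forall x, ~ S x -> psi n x = 0,
      forall i, measurable_fun (A : set (lebT R d)) (g i : lebT R d -> R),
      (\int[leb]_(x in A) ((f x - psi n x) ^+ 2)%:E)%E @[n --> \oo] --> 0%E &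
      forall i, (\int[leb]_(x in A) ((g i x - partial i (psi n) x) ^+ 2)%:E)%E
        @[n --> \oo] --> 0%E].

Definition agg_bubble (c C : R) A (f : sfun) : Prop :=
  [/\ H10 (agg Om A) f,
      forall K, active Om K -> owner K = A -> exists2 g, polyQ 2 g &
        forall x, ocell K x -> Om x -> f x = g x,
      exists u i, [/\ Vh u, forall x, agg Om A x -> u x 0 i = f x &
        forall x, Om x -> ~ agg Om A x -> u x 0 i = 0] &
      [/\ forall x, agg Om A x -> 0 <= f x,
          c * fine (leb (agg Om A)) < \int[leb]_(x in agg Om A) f x,
          (0 < leb (agg Om A))%E &
          forall x, agg Om A x -> `|f x| <= C]].

(* Constants of the interface bubbles (bF1, bF2) and of the aggregate bubbles
   (bA1, bA2). *)
Record bubble_consts := BubbleConsts { bF1 : R; bF2 : R; bA1 : R; bA2 : R }.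
Definition bubble_consts_pos (c : bubble_consts) : Prop :=
  [/\ 0 < bF1 c, 0 < bF2 c, 0 < bA1 c & 0 < bA2 c].

Definition improper_iface (c : bubble_consts) A B : Prop :=
  is_iface A B /\ ~ exists u, iface_bubble (bF1 c) (bF2 c) A B u.
Definition improper_agg (c : bubble_consts) A : Prop :=
  internal Om A /\ ~ exists f, agg_bubble (bA1 c) (bA2 c) A f.

(* The order on cells only serves to count each interface once. *)
Definition jump_term (c : bubble_consts) p : R :=
  \sum_(A : cell) \sum_(B : cell | (enum_rank A < enum_rank B)%N &&
      `[< improper_iface c A B >])
    h * \int[surf]_(x in iface A B) (jump p A B x ^+ 2).
Definition fluctuation_term (c : bubble_consts) p : R :=
  \sum_(A : cell | `[< improper_agg c A >])
    \int[leb]_(x in agg Om A) ((p x - pi0 p x) ^+ 2).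

Definition bilinear_on (W : vfun * sfun -> Prop)
    (j : vfun * sfun -> vfun * sfun -> R) : Prop :=
  (forall (a : R) w1 w2 z, W w1 -> W w2 -> W z ->
     j (a *: w1 + w2) z = a * j w1 z + j w2 z) /\
  (forall (a : R) w z1 z2, W w -> W z1 -> W z2 ->
     j w (a *: z1 + z2) = a * j w z1 + j w z2).

End stokes.

Arguments bubble_consts R : clear implicits.

(* Main.v *)
Require Import Defs.
From mathcomp Require Import all_boot all_order all_algebra.
From mathcomp Require Import all_classical all_reals all_analysis.
From mathcomp Require Import ring lra.
Import Order.TTheory GRing.Theory Num.Theory.
Import numFieldNormedType.Exports.
Set Implicit Arguments.
Unset Strict Implicit.
Unset Printing Implicit Defensive.
Local Open Scope classical_set_scope.
Local Open Scope ring_scope.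

(** Write N for the norm of (u, p), U and P for those of u and p, J for the sum
    of the jump and fluctuation terms, s for the supremum, and M = s N.

    Testing with (u, - p) cancels the two b_h terms; coercivity of a_h and the
    stabilization bound give gamma_a / 2 U^2 + gamma_j J <= M. Testing with
    (v, 0), where v comes from the weak inf-sup condition, produces P^2 / beta_q
    up to J, to a_h u v and to the stabilization terms j_h (u, 0) (v, 0) and
    j_h (0, p) (v, 0). The terms that pair u with v are absorbed by Young's
    inequality, as U^2 is already bounded by M.

    The term j_h (0, p) (v, 0) is the delicate one: by continuity it is only
    bounded by xi_j P^2, with a factor that is not small, and Cauchy-Schwarz is
    not available since j_h need not be symmetric. Two applications of the
    stabilization bounds replace it. Adding those at (- t v, p) and (t v, p)
    bounds t j_h (0, p) (v, 0) by j_h (0, p) (0, p) plus a multiple of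
    t^2 |||v|||^2 (j_cross), and the bound at (2 u, p) shows that
    j_h (0, p) (0, p) <= 2 M (j_pressure). A suitable t then makes the
    remaining multiple of |||v|||^2 <= P^2 small against P^2 / beta_q. Hence
    N^2 = U^2 + P^2 <= beta_d M = beta_d s N (abstract_inf_sup).

    The argument never adds two velocities or two pressures inside a_h, b_h or a
    norm; it only rescales them. This matters because an integral is homogeneous
    for every function, measurable or not (RintegralZ), whereas its additivity
    would require integrability of all the traces and gradients that occur on
    the domain and on its boundary. The rest of the file shows that the spaces,
    the forms and the norms are compatible with scaling. The one subtle point
    there is that the cellwise polynomials, which are selected by a choice
    operator, are unique, a polynomial being determined by its values on a
    nondegenerate box (poly_span_box0). *)

(** * Homogeneity of integrals without measurability *)

Section integral_scaling.
Context d (T : measurableType d) (R : realType).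
Variable mu : {measure set T -> \bar R}.
Implicit Types (D : set T).
Local Open Scope ereal_scope.
Import HBNNSimple.

Let ge0_integralZ_le D (f : T -> \bar R) k : (0 < k)%R ->
  (forall x, D x -> 0 <= f x) ->
  k%:E * \int[mu]_(x in D) f x <= \int[mu]_(x in D) (k%:E * f x).
Proof.
move=> k0 f0; have k0' := ltW k0.
rewrite muleC -lee_pdivlMr//.
rewrite !ge0_integralE//; last by move=> x Dx; rewrite mule_ge0// ?lee_fin ?f0.
apply: ge_ereal_sup => _ [g /= gf <-].
rewrite lee_pdivlMr// muleC -sintegralrM.
apply: ereal_sup_ubound; exists (scale_nnsfun g k0') => //= x.
by rewrite erestrict_scale EFinM lee_pmul2l.
Qed.

(** Scaling is a bijection of the simple functions below f onto those below k f,
    so the supremum that defines the integral scales for any f. *)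
Lemma ge0_integralZ D (f : T -> \bar R) k : (0 < k)%R ->
  (forall x, D x -> 0 <= f x) ->
  \int[mu]_(x in D) (k%:E * f x) = k%:E * \int[mu]_(x in D) f x.
Proof.
move=> k0 f0; apply/eqP; rewrite eq_le ge0_integralZ_le// andbT.
have kf x : D x -> 0 <= k%:E * f x.
  by move=> Dx; rewrite mule_ge0// ?lee_fin ?(ltW k0) ?f0.
have k'0 : (0 < k^-1)%R by rewrite invr_gt0.
have := @ge0_integralZ_le D _ _ k'0 kf.
rewrite [X in _ <= X -> _](eq_integral f) => [|x _]; last first.
  by rewrite muleA -EFinM mulVf ?gt_eqF// mul1e.
by rewrite muleC lee_pdivrMr// muleC.
Qed.

(** An integral of the form oo - oo or of infinite value has real value 0 by
    convention, which is compatible with the sign change. *)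
Let RintegralN D (f : T -> R) :
  (\int[mu]_(x in D) (- f x) = - \int[mu]_(x in D) f x)%R.
Proof.
rewrite /Rintegral; under eq_integral do rewrite EFinN.
rewrite integralE [in RHS]integralE funeposN funenegN.
move: (integral _ _ _) (integral _ _ _) => [x| |] [y| |] //=;
  by rewrite ?oppr0// opprB.
Qed.

Let RintegralZ_gt0 D (f : T -> R) k : (0 < k)%R ->
  (\int[mu]_(x in D) (k * f x) = k * \int[mu]_(x in D) f x)%R.
Proof.
move=> k0; rewrite /Rintegral; under eq_integral do rewrite EFinM.
rewrite integralE [in RHS]integralE.
rewrite ge0_funeposM ?ge0_funenegM ?ltW// !ge0_integralZ//.
move: (integral _ _ _) (integral _ _ _) => [x| |] [y| |] //=;
  by rewrite ?gt0_muley ?gt0_muleNy ?lte_fin//= ?mulr0// mulrBr.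
Qed.

Lemma RintegralZ D (f : T -> R) k :
  (\int[mu]_(x in D) (k * f x) = k * \int[mu]_(x in D) f x)%R.
Proof.
have [k0|k0|->] := ltgtP k 0%R.
- rewrite -[k]opprK mulNr -RintegralZ_gt0 ?oppr_gt0// -RintegralN.
  by under eq_Rintegral do rewrite mulNr.
- exact: RintegralZ_gt0.
rewrite mul0r /Rintegral; under eq_integral do rewrite mul0r.
by rewrite integral0.
Qed.

Lemma eq_RintegralZ D (f g : T -> R) k :
  (forall x, D x -> f x = k * g x)%R ->
  (\int[mu]_(x in D) f x = k * \int[mu]_(x in D) g x)%R.
Proof.
move=> fg; rewrite -RintegralZ; apply: eq_Rintegral => x.
by rewrite inE => /fg.
Qed.

End integral_scaling.
Arguments eq_RintegralZ {d T R} mu {D f} g k.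

(** * Polynomials on boxes *)

Section polynomials.
Context {R : realType} {d : nat}.
Implicit Types (f g : 'rV[R]_d -> R) (a b x : 'rV[R]_d).

Lemma poly_spanB m (P : pred (multiindex m)) f g :
  poly_span P f -> poly_span P g -> poly_span P (f - g).
Proof.
move=> [c fE] [e gE]; exists (fun al => c al - e al) => x.
by rewrite !fctE fE gE -sumrB; apply: eq_bigr => al _; rewrite mulrBl.
Qed.

Lemma poly_spanZ m (P : pred (multiindex m)) k f :
  poly_span P f -> poly_span P (k *: f).
Proof.
move=> [c fE]; exists (fun al => k * c al) => x.
rewrite !fctE fE scaler_sumr; apply: eq_bigr => al _.
by rewrite /GRing.scale/= mulrA.
Qed.

Let setc x (i : 'I_d) (t : R) : 'rV[R]_d :=
  \row_k (if k == i then t else x 0 k).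

Let setcE x i : setc x i (x 0 i) = x.
Proof. by apply/rowP => k; rewrite mxE; case: eqP => [->|]. Qed.

Let poly_span_line m (P : pred (multiindex m)) f x i : poly_span P f ->
  exists q : {poly R}, forall t, f (setc x i t) = q.[t].
Proof.
move=> [c fE].
exists (\sum_(al | P al) (c al)%:P *
  \prod_k (if k == i then 'X else (x 0 k)%:P) ^+ al k) => t.
rewrite fE horner_sum; apply: eq_bigr => al _.
rewrite hornerCM horner_prod; congr (_ * _); apply: eq_bigr => k _.
by rewrite horner_exp mxE; case: ifP; rewrite ?hornerX ?hornerC.
Qed.

(** More equidistant roots in [a, b] than the degree allows. *)
Let poly_itv0 (q : {poly R}) (a b : R) : a < b ->
  (forall t, a <= t <= b -> q.[t] = 0) -> q = 0.
Proof.
move=> ab q0; apply/eqP/negPn/negP => qN0.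
pose r (k : nat) : R := a + (b - a) * (k%:R / (size q)%:R).
have sq : (0 < size q)%N by rewrite size_poly_gt0.
have sqR : 0 < (size q)%:R :> R by rewrite ltr0n.
have ba : 0 < b - a by rewrite subr_gt0.
have rI : injective r.
  move=> k l /addrI /(mulfI (lt0r_neq0 ba)).
  move=> /(mulIf (invr_neq0 (lt0r_neq0 sqR))).
  by move=> /eqP; rewrite eqr_nat => /eqP.
have := @max_poly_roots _ q (map r (iota 0 (size q))) qN0.
rewrite size_map size_iota ltnn => H; apply: notF; apply: H.
  apply/allP => _ /mapP[k + ->]; rewrite mem_iota add0n => /andP[_ kq].
  apply/eqP; apply: q0; rewrite /r lerDl.
  rewrite mulr_ge0 ?(ltW ba) ?divr_ge0 ?ler0n//=.
  rewrite -lerBrDl -[leRHS]mulr1 ler_pM2l// ler_pdivrMr// mul1r ler_nat.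
  exact: ltnW.
by rewrite map_inj_uniq// iota_uniq.
Qed.

(** Induction on the number k of leading coordinates that are allowed to leave
    the box: freeing one more amounts to a polynomial in one variable that
    vanishes on an interval. *)
Lemma poly_span_box0 m (P : pred (multiindex m)) f a b :
  (forall i, a 0 i < b 0 i) -> poly_span P f ->
  (forall x, box a b x -> f x = 0) -> forall x, f x = 0.
Proof.
move=> ab fP f0.
have H k : forall x, (forall i : 'I_d, (k <= i)%N -> a 0 i <= x 0 i <= b 0 i) ->
    f x = 0.
  elim: k => [|k IH] x xk; first by apply: f0 => i; exact: xk.
  have [kd|dk] := ltnP k d; last first.
    apply: IH => i ki; have := ltn_ord i.
    by rewrite ltnNge (leq_trans dk).
  pose i := Ordinal kd.
  have [q qE] := poly_span_line x i fP.
  have q0 : q = 0.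
    apply: (poly_itv0 (ab i)) => t tab; rewrite -qE; apply: IH => l kl.
    rewrite mxE; case: eqP => [->//|/eqP li]; apply: xk.
    by rewrite ltn_neqAle kl andbT eq_sym -(inj_eq val_inj) in li *.
  by rewrite -(setcE x i) qE q0 horner0.
by move=> x; apply: (H d) => i; rewrite leqNgt ltn_ord.
Qed.

Lemma restr_polyE m (P : pred (multiindex m)) f g (A : set 'rV[R]_d) a b :
  (forall i, a 0 i < b 0 i) -> box a b `<=` A ->
  poly_span P g -> (forall x, A x -> f x = g x) ->
  restr_poly (poly_span P) f A = g.
Proof.
move=> ab abA Pg fg; rewrite /restr_poly.
case: xgetP => [g' _ [Pg' fg']|/(_ g)]; last by case.
apply/funext => x; apply/eqP; rewrite -subr_eq0; apply/eqP.
apply: (poly_span_box0 ab (poly_spanB Pg' Pg)) => y aby.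
by rewrite !fctE -fg' ?fg ?subrr//; exact: abA.
Qed.

Lemma restr_polyZ m (P : pred (multiindex m)) k f g (A : set 'rV[R]_d) a b :
  (forall i, a 0 i < b 0 i) -> box a b `<=` A ->
  poly_span P g -> (forall x, A x -> f x = g x) ->
  restr_poly (poly_span P) (k *: f) A = k *: restr_poly (poly_span P) f A.
Proof.
move=> ab abA Pg fg; rewrite (restr_polyE ab abA Pg fg).
apply: (restr_polyE ab abA (poly_spanZ k Pg)) => x Ax.
by rewrite !fctE fg.
Qed.

Lemma poly_span_derivable m (P : pred (multiindex m)) f x v :
  poly_span P f -> derivable f x v.
Proof.
move=> [c fE].
have -> : f = \sum_(al | P al)
    c al *: \prod_(i < d) (fun y : 'rV[R]_d => y 0 i) ^+ al i.
  apply/funext => y; rewrite fE fct_sumE; apply: eq_bigr => al _.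
  rewrite fctE; congr (_ * _); rewrite fct_prodE; apply: eq_bigr => i _.
  by rewrite fctE.
elim/big_ind: _ => [|f1 f2 d1 d2|al _]; first exact: derivable_cst.
  exact: derivableD.
apply: derivableZ; elim/big_ind: _ => [|f1 f2 d1 d2|i _].
- exact: derivable_cst.
- exact: derivableM.
apply: derivableX; apply: diff_derivable; exact: differentiable_coord.
Qed.

Lemma partialZ m (P : pred (multiindex m)) k f i : poly_span P f ->
  partial i (k *: f) = k *: partial i f.
Proof.
move=> Pf; apply/funext => x; rewrite /partial fctE deriveZ//.
exact: poly_span_derivable Pf.
Qed.

End polynomials.

(** * Inf-sup stability in abstract spaces *)

Section abstract_inf_sup.
Context {R : realType} {X Y : lmodType R}.
Variables (inX : X -> Prop) (inY : Y -> Prop) (nX : X -> R) (nY : Y -> R).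
Variables (a : X -> X -> R) (b : X -> Y -> R) (j : X * Y -> X * Y -> R).
Variable J : Y -> R.
Variables (ca xa cb cj xj : R).

Let nW (w : X * Y) : R := Num.sqrt (nX w.1 ^+ 2 + nY w.2 ^+ 2).
Let inW (w : X * Y) : Prop := inX w.1 /\ inY w.2.
Let A (w z : X * Y) : R := a w.1 z.1 + b z.1 w.2 + b w.1 z.2 - j w z.

(** The first summand bounds U^2 / M and the second P^2 / M. *)
Definition inf_sup_const : R :=
  2 / ca + 2 * cb * (1 + cj^-1 + 4 * cb * ca + 2 * cb * (xa + xj) ^+ 2 / ca).

Hypotheses (ca_gt0 : 0 < ca) (xa_gt0 : 0 < xa) (cb_gt0 : 0 < cb)
  (cj_gt0 : 0 < cj) (xj_gt0 : 0 < xj).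
Hypotheses (inX0 : inX 0) (inXZ : forall k u, inX u -> inX (k *: u)).
Hypotheses (inY0 : inY 0) (inYZ : forall k p, inY p -> inY (k *: p)).
Hypotheses (nX_ge0 : forall u, 0 <= nX u) (nY_ge0 : forall p, 0 <= nY p).
Hypothesis nXZ : forall k u, inX u -> nX (k *: u) = `|k| * nX u.
Hypothesis nYZ : forall k p, inY p -> nY (k *: p) = `|k| * nY p.
Hypothesis aN : forall u v, inX u -> inX v -> a u (- v) = - a u v.
Hypothesis bZ : forall k u p, inX u -> inY p -> b u (k *: p) = k * b u p.
Hypothesis jDl : forall k w1 w2 z, inW w1 -> inW w2 -> inW z ->
  j (k *: w1 + w2) z = k * j w1 z + j w2 z.
Hypothesis jDr : forall k w z1 z2, inW w -> inW z1 -> inW z2 ->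
  j w (k *: z1 + z2) = k * j w z1 + j w z2.
Hypothesis J_ge0 : forall p, 0 <= J p.
Hypothesis a_coer : forall u, inX u -> ca * nX u ^+ 2 <= a u u.
Hypothesis a_cont : forall u v, inX u -> inX v -> a u v <= xa * nX u * nX v.
Hypothesis weak_inf_sup : forall p, inY p -> exists2 v, inX v &
  cb^-1 * nY p ^+ 2 <= b v p + J p /\ nX v <= nY p.
Hypothesis j_psd : forall u p, inX u -> inY p -> 0 <= j (u, p) (u, p).
Hypothesis j_stab : forall u p, inX u -> inY p ->
  cj * J p - ca / 2 * nX u ^+ 2 <= j (u, p) (u, p).
Hypothesis j_stabN : forall u p, inX u -> inY p ->
  cj * J p - ca / 2 * nX u ^+ 2 <= - j (u, p) (u, - p).
Hypothesis j_cont : forall w z, inW w -> inW z -> j w z <= xj * nW w * nW z.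

Let inXN u : inX u -> inX (- u). Proof. by rewrite -scaleN1r; exact: inXZ. Qed.
Let inYN p : inY p -> inY (- p). Proof. by rewrite -scaleN1r; exact: inYZ. Qed.
Let nXN u : inX u -> nX (- u) = nX u.
Proof. by move=> Xu; rewrite -scaleN1r nXZ// normrN1 mul1r. Qed.
Let nYN p : inY p -> nY (- p) = nY p.
Proof. by move=> Yp; rewrite -scaleN1r nYZ// normrN1 mul1r. Qed.
Let nY0 : nY 0 = 0.
Proof. by rewrite -[0 in LHS](scale0r (0 : Y)) nYZ// normr0 mul0r. Qed.
Let inW0 : inW 0. Proof. by []. Qed.
Let nWX v : nW (v, 0) = nX v.
Proof. by rewrite /nW/= nY0 expr0n addr0 sqrtr_sqr ger0_norm. Qed.

Let j0r w : inW w -> j w 0 = 0.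
Proof.
by move=> Ww; have := jDr (-1) Ww inW0 inW0; rewrite scaler0 addr0 mulN1r addNr.
Qed.

Let j0l z : inW z -> j 0 z = 0.
Proof.
by move=> Wz; have := jDl (-1) inW0 inW0 Wz; rewrite scaler0 addr0 mulN1r addNr.
Qed.

Let jZr k w z : inW w -> inW z -> j w (k *: z) = k * j w z.
Proof. by move=> Ww Wz; rewrite -[k *: z]addr0 jDr// j0r// addr0. Qed.

Let jZl k w z : inW w -> inW z -> j (k *: w) z = k * j w z.
Proof. by move=> Ww Wz; rewrite -[k *: w]addr0 jDl// j0l// addr0. Qed.

Let pairE (u : X) (p : Y) : (u, p) = 1 *: (u, 0) + (0, p).
Proof. by rewrite scale1r; congr pair; rewrite /= ?addr0 ?add0r. Qed.

Let scaleX k (u : X) : (k *: u, 0 : Y) = k *: (u, 0).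
Proof. by congr pair; rewrite /= scaler0. Qed.

Let scaleY k (p : Y) : (0 : X, k *: p) = k *: (0, p).
Proof. by congr pair; rewrite /= scaler0. Qed.

Let j_blocks k k' l u p v q : inX u -> inY p -> inX v -> inY q ->
  j (k *: u, p) (k' *: v, l *: q) =
    k * k' * j (u, 0) (v, 0) + k * l * j (u, 0) (0, q)
    + k' * j (0, p) (v, 0) + l * j (0, p) (0, q).
Proof.
move=> Xu Yp Xv Yq.
have inWx x c : inX x -> inW (c *: x, 0) by move=> Xx; split; first exact: inXZ.
have inWy y c : inY y -> inW (0, c *: y) by move=> Yy; split; last exact: inYZ.
have Wz : inW (k' *: v, l *: q) by split; [exact: inXZ|exact: inYZ].
have W0p : inW (0, p) by [].
have [Wu Wv Wq] := And3 (inWx _ k Xu) (inWx _ k' Xv) (inWy _ l Yq).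
rewrite [in LHS](pairE (k *: u)) jDl// (pairE (k' *: v)) !jDr// !mul1r.
rewrite !(scaleX k u) !(scaleX k' v) !(scaleY l q).
rewrite !(jZl, jZr) ?scaleX -?scaleX -?scaleY//; ring.
Qed.

Let j_diag k u p : inX u -> inY p ->
  j (k *: u, p) (k *: u, p) =
    k ^+ 2 * j (u, 0) (u, 0)
    + k * (j (u, 0) (0, p) + j (0, p) (u, 0)) + j (0, p) (0, p).
Proof.
move=> Xu Yp; rewrite -[in X in j _ X](scale1r p) j_blocks//; ring.
Qed.

Let j_diagN k u p : inX u -> inY p ->
  - j (k *: u, p) (k *: u, - p) =
    - k ^+ 2 * j (u, 0) (u, 0)
    + k * (j (u, 0) (0, p) - j (0, p) (u, 0)) + j (0, p) (0, p).
Proof.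
move=> Xu Yp; rewrite -[- p]scaleN1r j_blocks//; ring.
Qed.

Let nXZ2 k u : inX u -> nX (k *: u) ^+ 2 = k ^+ 2 * nX u ^+ 2.
Proof. by move=> Xu; rewrite nXZ// exprMn real_normK ?num_real. Qed.

(** The sum of j_stab at (- t v, p) and of j_stabN at (t v, p): in both
    j (v, 0) (v, 0) and j (v, 0) (0, p) occur with opposite signs, so that only
    the cross term with the pressure in the first argument survives. *)
Let j_cross p v t : inY p -> inX v ->
  t * j (0, p) (v, 0) <=
    j (0, p) (0, p) - cj * J p + ca / 2 * (t ^+ 2 * nX v ^+ 2).
Proof.
move=> Yp Xv.
have H1 := j_stab (inXZ (- t) Xv) Yp.
have H2 := j_stabN (inXZ t Xv) Yp.
rewrite j_diag// nXZ2// in H1; rewrite j_diagN// nXZ2// in H2.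
lra.
Qed.

(** Passing from (u, p) to (2 u, p) in j_stabN doubles the cross terms;
    subtracting twice the quantity bounded by M eliminates them and leaves
    - j (0, p) (0, p) - 2 j (u, 0) (u, 0), where the last term has a sign. The
    multiples of nX u ^ 2 are compensated by the coercivity of a. *)
Let j_pressure u p M : inX u -> inY p -> a u u - j (u, p) (u, - p) <= M ->
  j (0, p) (0, p) + cj * J p <= 2 * M.
Proof.
move=> Xu Yp HM.
have H2 := j_stabN (inXZ 2 Xu) Yp.
have H0 := j_psd Xu inY0.
have Ha := a_coer Xu.
have E := j_diagN 1 Xu Yp.
rewrite scale1r in E; rewrite j_diagN// nXZ2// in H2.
lra.
Qed.

Section quotient_bound.
Variables (u : X) (p : Y) (s : R).
Hypotheses (Xu : inX u) (Yp : inY p).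
Hypothesis s_ub : forall z, inW z -> A (u, p) z / nW z <= s.

Let U := nX u.
Let P := nY p.
Let N := nW (u, p).

Let NE : N ^+ 2 = U ^+ 2 + P ^+ 2.
Proof. by rewrite /N /nW sqr_sqrtr// addr_ge0// sqr_ge0. Qed.

Let test z : inW z -> 0 < nW z -> A (u, p) z <= s * nW z.
Proof. by move=> Wz z0; rewrite -ler_pdivrMr//; exact: s_ub. Qed.

Let test_symmetric : 0 < N -> a u u - j (u, p) (u, - p) <= s * N.
Proof.
move=> N0; have NN : nW (u, - p) = N by rewrite /N /nW/= nYN.
have := @test (u, - p); rewrite NN => /(_ (conj Xu (inYN Yp)) N0).
by rewrite /A /= -[in b _ (- p)]scaleN1r bZ//; lra.
Qed.

Let le_stab : 0 < N -> ca / 2 * U ^+ 2 + cj * J p <= s * N.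
Proof.
move=> N0; have := test_symmetric N0.
by have := j_stabN Xu Yp; have := a_coer Xu; rewrite -/U; lra.
Qed.

(** If v has norm 0, the quotient at (v, 0) carries no information. The test
    pair (v, t p) has positive norm, at most nX v + t P, and t tends to 0. *)
Let test_velocity v : inX v -> 0 < N -> 0 < P -> nX v <= P ->
  a u v + b v p - j (u, p) (v, 0) <= s * nX v.
Proof.
move=> Xv N0 P0 vP.
have s0 : 0 <= s.
  have H := le_stab N0; have J0 := J_ge0 p.
  have U0 : 0 <= ca / 2 * U ^+ 2 by rewrite mulr_ge0 ?sqr_ge0// divr_ge0// ltW.
  have {}J0 : 0 <= cj * J p by rewrite mulr_ge0// ltW.
  by rewrite -(pmulr_lge0 _ N0); lra.
pose e := b u p - j (u, p) (0, p).
apply/ler_addgt0Pr => eps eps0.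
have D0 : 0 < `|e| + s * P + 1 by rewrite ltr_wpDl// addr_ge0// mulr_ge0// ltW.
have [t t0 tE] : exists2 t : R, 0 < t & t * (`|e| + s * P + 1) = eps.
  by exists (eps / (`|e| + s * P + 1)); rewrite ?divr_gt0// divfK// gt_eqF.
have Wz : inW (v, t *: p) by split => //=; exact: inYZ.
have nz : nW (v, t *: p) <= nX v + t * P.
  rewrite /nW/= nYZ// gtr0_norm// -/P.
  have tP0 : 0 <= t * P by rewrite mulr_ge0// ltW.
  rewrite -(ler_pXn2r (n:=2)) ?nnegrE ?sqrtr_ge0 ?addr_ge0//.
  rewrite sqr_sqrtr ?addr_ge0 ?sqr_ge0// sqrrD lerD2r lerDl.
  by rewrite mulrn_wge0// mulr_ge0.
have nz0 : 0 < nW (v, t *: p).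
  rewrite /nW/= nYZ// gtr0_norm// -/P sqrtr_gt0 ltr_wpDl ?sqr_ge0//.
  by rewrite exprn_gt0// mulr_gt0.
have := test Wz nz0; rewrite /A/= bZ//.
have := j_blocks 1 1 t Xu Yp Xv Yp; have := j_blocks 1 1 0 Xu Yp Xv Yp.
have := j_blocks 1 0 1 Xu Yp Xv Yp.
rewrite !scale1r !scale0r => E1 E2 E3.
have : s * nW (v, t *: p) <= s * nX v + t * (s * P).
  by rewrite mulrCA -mulrDr ler_wpM2l.
have : - (t * `|e|) <= t * e.
  by rewrite -mulrN ler_pM2l// lerNl -normrN ler_norm.
rewrite -tE E3 E2 /e E1; nra.
Qed.

(** The case P = 0 is apart because the test pair (v, t p) needs a pressure of
    positive norm. *)
Lemma inf_sup_quotient : N <= inf_sup_const * s.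
Proof.
have [N0|N0] := eqVneq N 0.
  have := s_ub (conj Xu Yp : inW (u, p)); rewrite -/N N0 invr0 mulr0 => s0.
  apply: mulr_ge0 => //; rewrite /inf_sup_const.
  have [ca0 cb0 cj0] := And3 (ltW ca_gt0) (ltW cb_gt0) (ltW cj_gt0).
  by rewrite !(sqr_ge0, ler0n, ler01, invr_ge0, addr_ge0, mulr_ge0).
have {}N0 : 0 < N by rewrite lt0r N0 sqrtr_ge0.
have Hstab := le_stab N0.
have Hj22 := j_pressure Xu Yp (test_symmetric N0).
set M := s * N in Hstab Hj22.
have cJ0 : 0 <= cj * J p by rewrite mulr_ge0// ltW.
have cU0 : 0 <= ca / 2 * U ^+ 2 by rewrite mulr_ge0 ?sqr_ge0// divr_ge0// ltW.
have M0 : 0 <= M by lra.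
have s0 : 0 <= s by rewrite -(pmulr_lge0 _ N0).
have UM : U ^+ 2 <= 2 / ca * M.
  by rewrite mulrAC ler_pdivlMr//; lra.
have JM : J p <= cj^-1 * M by rewrite ler_pdivlMl//; lra.
set x := xa + xj.
have x0 : 0 < x by rewrite addr_gt0.
suff PM : P ^+ 2 <=
    2 * cb * (1 + cj^-1 + 4 * cb * ca + 2 * cb * x ^+ 2 / ca) * M.
  rewrite -(ler_pM2r N0) -mulrA -/M -expr2 NE /inf_sup_const mulrDl.
  by rewrite lerD.
have [P0|P0] := eqVneq P 0.
  rewrite P0 expr0n mulr_ge0//.
  have [ca0 cb0 cj0] := And3 (ltW ca_gt0) (ltW cb_gt0) (ltW cj_gt0).
  by rewrite !(sqr_ge0, ler0n, ler01, invr_ge0, addr_ge0, mulr_ge0).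
have {}P0 : 0 < P by rewrite lt0r P0 nY_ge0.
have [v Xv [Hv vP]] := weak_inf_sup Yp.
rewrite -/P in Hv vP.
have V0 := nX_ge0 v.
have T := test_velocity Xv N0 P0 vP.
have PN : P <= N.
  rewrite -(ler_pXn2r (n:=2)) ?nnegrE ?(ltW P0) ?(ltW N0)// NE lerDr.
  exact: sqr_ge0.
have sVM : s * nX v <= M by rewrite ler_wpM2l// (le_trans vP).
have Ha : - a u v <= xa * U * nX v.
  by rewrite -aN// -(nXN Xv) a_cont//; exact: inXN.
have Hj : j (u, 0) (v, 0) <= xj * U * nX v.
  by have := @j_cont (u, 0) (v, 0); rewrite !nWX => ->.
have E := j_blocks 1 1 0 Xu Yp Xv Yp.
rewrite !scale1r scale0r in E.
set V := nX v in V0 vP T sVM Ha Hj.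
have V2 : V ^+ 2 <= P ^+ 2 by rewrite ler_pXn2r ?nnegrE// ltW.
have Hj21 : j (0, p) (v, 0) <= 2 * cb * ca * (2 * M) + cb^-1 / 4 * V ^+ 2.
  (* This t, like the weights of Young's inequality in UV, leaves V^2 / (4 cb);
     half of P^2 / cb remains after both are absorbed. *)
  pose t := (2 * cb * ca)^-1.
  have t0 : 0 < 2 * cb * ca by rewrite !mulr_gt0.
  have := j_cross t Yp Xv; rewrite /t ler_pdivrMl// => /le_trans; apply.
  rewrite -/V.
  have -> : 2 * cb * ca * (j (0, p) (0, p) - cj * J p +
      ca / 2 * ((2 * cb * ca)^-1 ^+ 2 * V ^+ 2)) =
    2 * cb * ca * (j (0, p) (0, p) - cj * J p) + cb^-1 / 4 * V ^+ 2.
    by field; rewrite !gt_eqF.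
  by rewrite lerD2r ler_pM2l//; lra.
have UV : x * U * V <= cb * x ^+ 2 * (2 / ca * M) + cb^-1 / 4 * V ^+ 2.
  have : 0 <= cb^-1 * (cb * x * U - V / 2) ^+ 2.
    by rewrite mulr_ge0 ?sqr_ge0// invr_ge0 ltW.
  have -> : cb^-1 * (cb * x * U - V / 2) ^+ 2 =
      cb * x ^+ 2 * U ^+ 2 + cb^-1 / 4 * V ^+ 2 - x * U * V.
    by field; rewrite gt_eqF.
  have : cb * x ^+ 2 * U ^+ 2 <= cb * x ^+ 2 * (2 / ca * M).
    by rewrite ler_wpM2l// mulr_ge0 ?sqr_ge0// ltW.
  by lra.
have : cb^-1 / 4 * V ^+ 2 <= cb^-1 / 4 * P ^+ 2.
  by rewrite ler_wpM2l// divr_ge0// invr_ge0 ltW.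
have xUV : xa * U * V + xj * U * V = x * U * V by rewrite /x; ring.
move=> VP.
have : cb^-1 / 2 * P ^+ 2 <=
    (1 + cj^-1 + 4 * cb * ca + 2 * cb * x ^+ 2 / ca) * M.
  have -> : (1 + cj^-1 + 4 * cb * ca + 2 * cb * x ^+ 2 / ca) * M =
    M + cj^-1 * M + 2 * cb * ca * (2 * M) + cb * x ^+ 2 * (2 / ca * M) by ring.
  by lra.
have -> : cb^-1 / 2 * P ^+ 2 = (2 * cb)^-1 * P ^+ 2.
  by rewrite invfM [2^-1 * _]mulrC.
by rewrite ler_pdivrMl ?mulr_gt0// mulrA.
Qed.

End quotient_bound.

Lemma inf_sup_const_gt0 : 0 < inf_sup_const.
Proof.
have [ca0 cb0 cj0] := And3 (ltW ca_gt0) (ltW cb_gt0) (ltW cj_gt0).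
rewrite /inf_sup_const ltr_pwDl ?divr_gt0//.
have x0 : 0 <= xa + xj by rewrite addr_ge0// ltW.
by rewrite !(sqr_ge0, ler0n, ler01, invr_ge0, addr_ge0, mulr_ge0).
Qed.

Lemma abstract_inf_sup u p : inX u -> inY p ->
  ((inf_sup_const^-1 * nW (u, p))%:E <=
   ereal_sup [set (A (u, p) z / nW z)%:E | z in inW])%E.
Proof.
move=> Xu Yp; set S := ereal_sup _.
have ubS z : inW z -> ((A (u, p) z / nW z)%:E <= S)%E.
  by move=> Wz; apply: ereal_sup_ubound; exists z.
case: S ubS => [s||] ubS; last by have := ubS _ inW0.
  rewrite lee_fin ler_pdivrMl ?inf_sup_const_gt0//.
  apply: (inf_sup_quotient Xu Yp) => z Wz; rewrite -lee_fin; exact: ubS.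
by rewrite leey.
Qed.

End abstract_inf_sup.

(** * Local polynomials of a discrete function *)

Section mesh_facts.
Context {R : realType} {d : nat}.
Variables (Om : set 'rV[R]_d) (T : agg_mesh R d) (kappa gamma : R).
Hypotheses (kappa_gt0 : 0 < kappa) (admT : admissible_mesh Om T kappa gamma).
Notation cell := (cell_of (nint T)).
Implicit Types (K A : cell) (x : 'rV[R]_d).

Let lo K : 'rV[R]_d := \row_i gpt T i (K i).
Let hi K : 'rV[R]_d := \row_i gpt T i (K i).+1.

Let lo_hi K i : lo K 0 i < hi K 0 i.
Proof.
case: admT => -[h0 hT _] _; rewrite !mxE -subr_gt0.
have /andP[+ _] := hT i (K i) (ltn_ord (K i)).
by apply: lt_le_trans; rewrite divr_gt0.
Qed.

Let box_ccell K : box (lo K) (hi K) `<=` ccell K.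
Proof. by move=> x xK i; have := xK i; rewrite !mxE. Qed.

Lemma restr_cell_polyZ q k f g K :
  polyQ q g -> (forall x, ccell K x -> f x = g x) ->
  restr_poly (polyQ q) (k *: f) (ccell K) =
  k *: restr_poly (polyQ q) f (ccell K).
Proof. exact: restr_polyZ (lo_hi K) (@box_ccell K). Qed.

Lemma restr_cell_polyE q f g K :
  polyQ q g -> (forall x, ccell K x -> f x = g x) ->
  restr_poly (polyQ q) f (ccell K) = g.
Proof. exact: restr_polyE (lo_hi K) (@box_ccell K). Qed.

Let ocell_open K : open (ocell K).
Proof.
rewrite openE => x xK.
pose near_i i : set 'rV[R]_d :=
  [set y | gpt T i (K i) < y 0 i < gpt T i (K i).+1].
suff H i : nbhs x (near_i i) by exact: (@filter_forall _ _ near_i (nbhs x)).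
have cx : nbhs (x 0 i) `]gpt T i (K i), gpt T i (K i).+1[%classic.
  apply: open_nbhs_nbhs; split; first exact: interval_open.
  by rewrite /= in_itv; exact: xK.
suff -> : near_i i = (fun y : 'rV[R]_d => y 0 i) @^-1`
    `]gpt T i (K i), gpt T i (K i).+1[%classic.
  exact: (@coord_continuous R 1 d 0 i x _ cx).
by apply/seteqP; split=> y /=; rewrite in_itv.
Qed.

Let ocell_agg A : internal Om A -> ocell A `<=` agg Om A.
Proof.
case: admT => _ [ownK _ _ _ _] intA x xA; split.
  by move: intA => /asboolP; apply.
exists A; first by rewrite /= /active intA ownK//= eqxx.
by move=> i; have /andP[/ltW -> /ltW ->] := xA i.
Qed.

(** The middle third in each direction, because the closed owner cell may meet
    the boundary of the aggregate. *)
Let box_agg A : internal Om A ->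
  box (lo A + 3^-1 *: (hi A - lo A)) (hi A - 3^-1 *: (hi A - lo A))
    `<=` interior (agg Om A).
Proof.
move=> intA x xA; have := @ocell_agg _ intA.
rewrite open_subsetE//; apply => i.
by have := xA i; have := lo_hi A i; rewrite !mxE => ? /andP[? ?]; lra.
Qed.

Lemma restr_agg_polyZ r k f g A : internal Om A -> Defs.polyP r g ->
  (forall x, interior (agg Om A) x -> f x = g x) ->
  restr_poly (Defs.polyP r) (k *: f) (interior (agg Om A)) =
  k *: restr_poly (Defs.polyP r) f (interior (agg Om A)).
Proof.
move=> intA; apply: restr_polyZ (box_agg intA) => i.
by have := lo_hi A i; rewrite !mxE; lra.
Qed.

Lemma cell_at_active x K : cell_at Om T x = Some K -> active Om K.
Proof. by rewrite /cell_at; case: pickP => // K' /andP[aK' _] [<-]. Qed.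

Lemma owner_internal K : active Om K -> internal Om (owner K).
Proof.
case: admT => _ [ownK cutK _ _ _] /orP[iK|/cutK//].
by rewrite ownK.
Qed.

End mesh_facts.

(** * Scaling in the discrete spaces *)

Section spaces.
Context {R : realType} {d : nat}.
Variables (Om : set 'rV[R]_d) (V : velocity_fe d) (T : agg_mesh R d).
Implicit Types (k : R) (u : 'rV[R]_d -> 'rV[R]_d) (p : 'rV[R]_d -> R).

Let owner_polyZ q b (N : {set multiindex q}) (v : 'rV[R]_d -> R)
    (K : cell_of (nint T)) g k :
  owner_poly b N v K g -> owner_poly b N (k *: v) K (k *: g).
Proof.
case: b => -[Pg vg]; (split; first exact: poly_spanZ) => x Nx.
  by rewrite !fctE vg.
by rewrite !fctE vg.
Qed.

Let agg_spaceZ q b (N : {set multiindex q}) v k :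
  agg_space Om T b N v -> agg_space Om T b N (k *: v).
Proof.
move=> [cv pv ov]; split.
- by move=> x; apply: cvgZl_tmp; exact: cv.
- move=> K /pv[g Pg vg]; exists (k *: g); first exact: poly_spanZ.
  by move=> x xK; rewrite !fctE vg.
- move=> x K /ov /[apply] -[g Pg vg]; exists (k *: g).
    exact: owner_polyZ.
  by rewrite !fctE vg.
Qed.

Lemma scale_comp k u i :
  (fun x => (k *: u) x 0 i) = k *: (fun x => u x 0 i) :> ('rV[R]_d -> R).
Proof. by apply/funext => x; rewrite !fctE mxE. Qed.

Lemma VhZ k u : Vh Om V T u -> Vh Om V T (k *: u).
Proof. by move=> Vu i; rewrite scale_comp; exact: agg_spaceZ (Vu i). Qed.

Let measurable_funZ k p :
  measurable_fun (Om : set (lebT R d)) (p : lebT R d -> R) ->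
  measurable_fun (Om : set (lebT R d)) (k *: p : lebT R d -> R).
Proof. by move=> mp; apply: measurable_realfun.measurable_funM. Qed.

Lemma QhZ k p : Qh Om V T p -> Qh Om V T (k *: p).
Proof.
move=> [[mp pp] [_ p2 p0]]; split; split; do ?exact: measurable_funZ.
- move=> A /pp[g Pg pg]; exists (k *: g); first exact: poly_spanZ.
  by move=> x xA; rewrite !fctE pg.
- have [->|k0] := eqVneq k 0.
    rewrite integral0_eq ?ltry// => x _.
    by rewrite !fctE scale0r expr0n.
  under eq_integral => x _ do rewrite fctE exprMn EFinM.
  rewrite ge0_integralZ ?exprn_even_gt0//=.
    by rewrite lte_mul_pinfty ?lee_fin ?sqr_ge0.
  by move=> x _; rewrite lee_fin sqr_ge0.
- by rewrite (eq_RintegralZ (@leb R d) p k) ?p0 ?mulr0.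
Qed.

End spaces.

(** * Scaling in the forms and norms *)

Section forms.
Context {R : realType} {d : nat}.
Variables (Om : set 'rV[R]_d) (nu : 'rV[R]_d -> 'rV[R]_d) (V : velocity_fe d).
Variables (T : agg_mesh R d) (kappa gamma : R).
Hypotheses (kappa_gt0 : 0 < kappa) (admT : admissible_mesh Om T kappa gamma).
Implicit Types (k : R) (u v : 'rV[R]_d -> 'rV[R]_d) (p : 'rV[R]_d -> R).

Lemma dotC (x y : 'rV[R]_d) : dot x y = dot y x.
Proof. by apply: eq_bigr => i _; rewrite mulrC. Qed.

Lemma dotZl k (x y : 'rV[R]_d) : dot (k *: x) y = k * dot x y.
Proof. by rewrite /dot mulr_sumr; apply: eq_bigr => i _; rewrite mxE mulrA. Qed.

Lemma dotZr k (x y : 'rV[R]_d) : dot x (k *: y) = k * dot x y.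
Proof. by rewrite dotC dotZl dotC. Qed.

Lemma gradZ k u x : Vh Om V T u ->
  grad Om V T (k *: u) x = k *: grad Om V T u x.
Proof.
move=> Vu; rewrite /grad.
case E: cell_at => [K|]; last by rewrite scaler0.
apply/matrixP => i j; rewrite !mxE scale_comp.
have [_ /(_ K (cell_at_active E))[g Pg ug] _] := Vu i.
rewrite (restr_cell_polyZ kappa_gt0 admT k Pg ug) //.
rewrite (restr_cell_polyE kappa_gt0 admT Pg ug) //.
by rewrite (partialZ k j Pg).
Qed.

Lemma dnormalZ k u x : Vh Om V T u ->
  dnormal Om nu V T (k *: u) x = k *: dnormal Om nu V T u x.
Proof. by move=> Vu; rewrite /dnormal gradZ// linearZ/= -scalemxAr. Qed.

Lemma traceZ k p x : Qh Om V T p ->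
  trace Om V T (k *: p) x = k * trace Om V T p x.
Proof.
move=> [[_ pp] _]; rewrite /trace.
case E: cell_at => [K|]; last by rewrite mulr0.
have iK := owner_internal admT (cell_at_active E).
have [g Pg pg] := pp _ iK.
by rewrite /agg_poly (restr_agg_polyZ kappa_gt0 admT k iK Pg pg).
Qed.

Lemma a_hZr tau k u v : Vh Om V T u -> Vh Om V T v ->
  a_h Om nu V T tau u (k *: v) = k * a_h Om nu V T tau u v.
Proof.
move=> Vu Vv; rewrite /a_h.
have EG :
    \int[leb]_(x in Om) \tr (grad Om V T u x *m (grad Om V T (k *: v) x)^T) =
    k * \int[leb]_(x in Om) \tr (grad Om V T u x *m (grad Om V T v x)^T).
  apply: eq_RintegralZ => x _.
  by rewrite gradZ// linearZ/= -scalemxAr linearZ.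
have E1 : \int[surf]_(x in bdry Om) dot (dnormal Om nu V T u x) ((k *: v) x) =
    k * \int[surf]_(x in bdry Om) dot (dnormal Om nu V T u x) (v x).
  by apply: eq_RintegralZ => x _; rewrite fctE dotZr.
have E2 : \int[surf]_(x in bdry Om) dot (dnormal Om nu V T (k *: v) x) (u x) =
    k * \int[surf]_(x in bdry Om) dot (dnormal Om nu V T v x) (u x).
  by apply: eq_RintegralZ => x _; rewrite dnormalZ// dotZl.
have E3 : \int[surf]_(x in bdry Om) dot ((msize T)^-1 *: u x) ((k *: v) x) =
    k * \int[surf]_(x in bdry Om) dot ((msize T)^-1 *: u x) (v x).
  by apply: eq_RintegralZ => x _; rewrite fctE dotZr.
by rewrite EG E1 E2 E3 !mulrDr !mulrN mulrCA.
Qed.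

Lemma b_hZr k v p : Qh Om V T p ->
  b_h Om nu V T v (k *: p) = k * b_h Om nu V T v p.
Proof.
move=> Qp; rewrite /b_h.
rewrite (eq_RintegralZ (@leb R d) (fun x => diver Om V T v x * p x) k);
  last first.
  by move=> x _; rewrite fctE mulrCA.
rewrite (eq_RintegralZ (@surf R d)
  (fun x => dot (nu x) (v x) * trace Om V T p x) k); last first.
  by move=> x _; rewrite traceZ// mulrCA.
by ring.
Qed.

Let sqrtZ k (x : R) : Num.sqrt (k ^+ 2 * x) = `|k| * Num.sqrt x.
Proof. by rewrite sqrtrM ?sqr_ge0// sqrtr_sqr. Qed.

Lemma L2normZ k p : L2norm Om (k *: p) = `|k| * L2norm Om p.
Proof.
rewrite /L2norm (eq_RintegralZ (@leb R d) (fun x => p x ^+ 2) (k ^+ 2)).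
  by rewrite sqrtZ.
by move=> x _; rewrite fctE exprMn.
Qed.

Lemma normVZ k u : Vh Om V T u ->
  normV Om V T (k *: u) = `|k| * normV Om V T u.
Proof.
move=> Vu; rewrite /normV -sqrtZ mulrDr.
rewrite (eq_RintegralZ (@leb R d)
  (fun x => \tr (grad Om V T u x *m (grad Om V T u x)^T)) (k ^+ 2)); last first.
  move=> x _; rewrite gradZ// [(k *: _)^T]linearZ/= -scalemxAr -scalemxAl.
  by rewrite !linearZ/= mulrA.
rewrite (eq_RintegralZ (@surf R d)
  (fun x => (msize T)^-1 * dot (u x) (u x)) (k ^+ 2))//.
by move=> x _; rewrite fctE dotZr dotZl; ring.
Qed.

Lemma jump_term_ge0 C p : 0 <= jump_term Om V T C p.
Proof.
have h0 : 0 <= msize T by case: admT => -[/ltW].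
apply: sumr_ge0 => A _; apply: sumr_ge0 => B _; apply: mulr_ge0 => //.
by apply: Rintegral_ge0 => x _; exact: sqr_ge0.
Qed.

Lemma fluctuation_term_ge0 C p : 0 <= fluctuation_term Om V T C p.
Proof.
apply: sumr_ge0 => A _.
by apply: Rintegral_ge0 => x _; exact: sqr_ge0.
Qed.

End forms.

(** * The discrete Stokes problem *)

Theorem theorem6p11 (R : realType) (d : nat) (hd : d = 2%N \/ d = 3%N)
  (Om : set 'rV[R]_d) (hOm : lipschitz_domain Om)
  (nu : 'rV[R]_d -> 'rV[R]_d) (hnu : outward_normal_field Om nu)
  (V : velocity_fe d) (hq : (2 <= deg V)%N)
  (hN : serendipity_unisolvent (R := R) (snodes V))
  (kappa gamma tau : R) (hkappa : 0 < kappa) (hgamma : 0 < gamma)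
  (htau : 0 < tau)
  (C : bubble_consts R) (hC : bubble_consts_pos C)
  (gamma_a xi_a beta_q gamma_j xi_j : R)
  (hgamma_a : 0 < gamma_a) (hxi_a : 0 < xi_a) (hbeta_q : 0 < beta_q)
  (hgamma_j : 0 < gamma_j) (hxi_j : 0 < xi_j) :
  exists2 beta_d : R, 0 < beta_d &
  forall (T : agg_mesh R d)
    (j_h : ('rV[R]_d -> 'rV[R]_d) * ('rV[R]_d -> R) ->
           ('rV[R]_d -> 'rV[R]_d) * ('rV[R]_d -> R) -> R),
  admissible_mesh Om T kappa gamma ->
  bilinear_on (Wh Om V T) j_h ->
  (* coercivity and continuity of a_h *)
  (forall u, Vh Om V T u ->
     gamma_a * normV Om V T u ^+ 2 <= a_h Om nu V T tau u u) ->
  (forall u v, Vh Om V T u -> Vh Om V T v ->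
     a_h Om nu V T tau u v <= xi_a * normV Om V T u * normV Om V T v) ->
  (* weak inf-sup condition *)
  (forall p, Qh Om V T p -> exists2 v, Vh Om V T v &
     beta_q^-1 * L2norm Om p ^+ 2 <=
       b_h Om nu V T v p + jump_term Om V T C p + fluctuation_term Om V T C p /\
     normV Om V T v <= L2norm Om p) ->
  (* pressure stabilization *)
  (forall u p, Vh Om V T u -> Qh Om V T p -> 0 <= j_h (u, p) (u, p)) ->
  (forall u p, Vh Om V T u -> Qh Om V T p ->
     fluctuation_term Om V T C p + jump_term Om V T C p
       - gamma_a / (2 * gamma_j) * normV Om V T u ^+ 2
     <= gamma_j^-1 * j_h (u, p) (u, p)) ->
  (* j_h enters A_h (u, p) (u, - p) through - j_h (u, p) (u, - p), which equals
     j_h (u, p) (u, p) when j_h is tested by pressures only; without this bound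
     the claim fails, e.g. for j_h (u, p) (v, q) = a_h u v on a mesh without
     improper interfaces and aggregates *)
  (forall u p, Vh Om V T u -> Qh Om V T p ->
     fluctuation_term Om V T C p + jump_term Om V T C p
       - gamma_a / (2 * gamma_j) * normV Om V T u ^+ 2
     <= gamma_j^-1 * - j_h (u, p) (u, - p)) ->
  (forall u p v q, Vh Om V T u -> Qh Om V T p -> Vh Om V T v -> Qh Om V T q ->
     j_h (u, p) (v, q) <= xi_j * normW Om V T (u, p) * normW Om V T (v, q)) ->
  (* inf-sup stability; a pair of norm 0 contributes 0 / 0 = 0 to the supremum,
     which is nonnegative in any case *)
  forall u p, Vh Om V T u -> Qh Om V T p ->
    ((beta_d^-1 * normW Om V T (u, p))%:E <=
     ereal_sup [set (A_h Om nu V T tau j_h (u, p) w / normW Om V T w)%:E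
                 | w in Wh Om V T])%E.
Proof.
have gj2 (a b c : R) : c - gamma_a / (2 * gamma_j) * a <= gamma_j^-1 * b ->
    gamma_j * c - gamma_a / 2 * a <= b.
  rewrite -(ler_pM2l hgamma_j) mulVKf ?gt_eqF// mulrBr.
  have -> : gamma_j * (gamma_a / (2 * gamma_j) * a) = gamma_a / 2 * a.
    by field; rewrite gt_eqF.
  by [].
exists (inf_sup_const gamma_a xi_a beta_q gamma_j xi_j).
  exact: inf_sup_const_gt0.
move=> T j admT [jDl jDr] coer cont wis psd stab stabN jcont u p Vu Qp.
pose J p := fluctuation_term Om V T C p + jump_term Om V T C p.
apply: (@abstract_inf_sup R _ _ (Vh Om V T) (Qh Om V T) (normV Om V T)
  (L2norm Om) (a_h Om nu V T tau) (b_h Om nu V T) j J) => //.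
- by rewrite -(scale0r u); exact: VhZ.
- by move=> k w Vw; exact: VhZ.
- by rewrite -(scale0r p); exact: QhZ.
- by move=> k w Qw; exact: QhZ.
- by move=> w; exact: sqrtr_ge0.
- by move=> w; exact: sqrtr_ge0.
- by move=> k w Vw; exact: normVZ hkappa admT _ _ Vw.
- by move=> k w _; exact: L2normZ.
- by move=> w v Vw Vv; rewrite -scaleN1r (a_hZr nu hkappa admT)// mulN1r.
- by move=> k w q _ Qq; rewrite (b_hZr nu hkappa admT).
- move=> q; rewrite /J addr_ge0 ?fluctuation_term_ge0//.
  exact: jump_term_ge0 admT _ _.
- move=> q /wis[v Vv [H vq]]; exists v => //; split => //.
  by rewrite /J addrA [_ + jump_term _ _ _ _ _]addrAC.
- by move=> w q Vw Qq; apply: gj2; exact: stab.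
- by move=> w q Vw Qq; apply: gj2; exact: stabN.
by move=> [w1 w2] [z1 z2] [/= ? ?] [/= ? ?]; exact: jcont.
Qed.
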